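(* Let $K\in\mathbb{R}^{p\times d}$, $A\in\mathbb{R}^{m\times d}$, $y\in\mathbb{R}^p$, and let $H:\mathbb{R}^m\to\mathbb{R}\cup\{+\infty\}$ be a proper, lower semi-continuous, convex function with convex conjugate $H^\ast$. Assume $\|K\|<\sqrt{2}$ and $\|A\|<1$ (operator norms), and that the variational equations $$K^T(y-Kx)-A^Tw=0\qquad\text{and}\qquad w=\mathrm{prox}_{H^\ast}(w+Ax)\qquad (V)$$ have at least one solution $(x,w)\in\mathbb{R}^d\times\mathbb{R}^m$. Given arbitrary $(x^0,w^0)\in\mathbb{R}^d\times\mathbb{R}^m$, define the sequence $(x^n,w^n)_{n\ge 0}$ by the iteration $$\left\{\begin{array}{lcl} \bar x^{n+1}&=&x^n+K^T(y-Kx^n)-A^Tw^n\\ w^{n+1}&=&\mathrm{prox}_{H^\ast}\left(w^n+A\bar x^{n+1}\right)\\ x^{n+1}&=&x^n+K^T(y-Kx^n)-A^Tw^{n+1}. \end{array}\right.$$ Let $$\mathcal{F}(x)=\tfrac12\|Kx-y\|^2+H(Ax),\qquad F(x,w)=\tfrac12\|Kx-y\|^2+\langle Ax,w\rangle-H^\ast(w).$$ Then: 1. The sequence $(x^n,w^n)$ converges to a solution $(x^\dagger,w^\dagger)$ of $(V)$; moreover $x^\dagger$ is a minimizer of $\mathcal{F}$ over $\mathbb{R}^d$, and $(x^\dagger,w^\dagger)$ is a saddle point of $\min_x\max_w F(x,w)$, i.e. $F(x^\dagger,w)\le F(x^\dagger,w^\dagger)\le F(x,w^\dagger)$ for all $x\in\mathbb{R}^d$,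 $w\in\mathbb{R}^m$. 2. The averages of the first $N$ iterates, $(\tilde x^N,\tilde w^N)=\frac1N\sum_{i=1}^N(x^i,w^i)$, $N\ge1$, converge to $(x^\dagger,w^\dagger)$ as $N\to\infty$, and there exists a constant $C_1\ge 0$, independent of $N$ (and of $x,w$ below), such that for all $N\ge 1$, all $x\in\mathbb{R}^d$ and all $w\in\mathbb{R}^m$ $$F(\tilde x^N,w)-F(x,\tilde w^N)\le\frac{\|x-x^0\|^2+\|w-w^0\|^2+C_1}{2N},$$ where one can take $C_1=0$ if $\|K\|\le 1$. In particular, with $G(x,w)=F(x,w^\dagger)-F(x^\dagger,w)$, $$0\le G(\tilde x^N,\tilde w^N)\le\frac{\|x^\dagger-x^0\|^2+\|w^\dagger-w^0\|^2+C_1}{2N}.$$ 3. If there is $R>0$ such that $H^\ast(w)=+\infty$ for all $w$ with $\|w\|>R$, then there exists a constant $C_2$, independent of $N$, such that $$0\le\mathcal{F}(\tilde x^N)-\mathcal{F}(x^\dagger)\le \frac{C_2}{N}\qquad\text{for all }N\ge 1.$$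
   Context: $\langle\cdot,\cdot\rangle$ and $\|\cdot\|$ denote the Euclidean inner product and norm on finite-dimensional real spaces, and for matrices $\|\cdot\|$ is the induced operator (spectral) norm. The convex conjugate is $H^\ast(w)=\sup_x\left(\langle w,x\rangle-H(x)\right)$, with values in $\mathbb{R}\cup\{+\infty\}$. The proximity operator is $\mathrm{prox}_{H^\ast}(u)=\arg\min_w\left(H^\ast(w)+\frac12\|w-u\|^2\right)$. $F(x,w)$ takes the value $-\infty$ when $H^\ast(w)=+\infty$. *)

(* Defs.v *)
(* R^n is 'cV[R]_n; its library norm is the sup norm, so the
   Euclidean norm and the induced operator norm are defined here. The library
   topology on 'cV[R]_n (entrywise) is the Euclidean one. *)
From HB Require Import structures.
From mathcomp Require Import all_boot all_order all_algebra.
From mathcomp Require Import all_classical all_reals all_analysis.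

Set Implicit Arguments.
Unset Strict Implicit.
Unset Printing Implicit Defensive.

Import Order.TTheory GRing.Theory Num.Theory.
Import numFieldNormedType.Exports.

Local Open Scope classical_set_scope.
Local Open Scope ring_scope.

Definition dot (R : realType) (n : nat) (u v : 'cV[R]_n) : R :=
  \sum_(i < n) u i 0 * v i 0.

Definition enorm (R : realType) (n : nat) (u : 'cV[R]_n) : R :=
  Num.sqrt (dot u u).

Definition opnorm (R : realType) (m n : nat) (M : 'M[R]_(m, n)) : R :=
  sup [set enorm (M *m x) | x in [set x : 'cV[R]_n | enorm x <= 1]].

(* H never takes the value -oo and is finite somewhere. *)
Definition eproper (R : realType) (n : nat) (H : 'cV[R]_n -> \bar R) : Prop :=
  (forall x, H x != -oo%E) /\ (exists x, H x != +oo%E).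

(* Only meaningful for H without the value -oo; note that 0 * +oo = 0. *)
Definition econvex (R : realType) (n : nat) (H : 'cV[R]_n -> \bar R) : Prop :=
  forall (x y : 'cV[R]_n) (t : R), 0 <= t <= 1 ->
    (H (t *: x + (1 - t) *: y)%R <= t%:E * H x + (1 - t)%:E * H y)%E.

Definition convex_conjugate (R : realType) (n : nat) (H : 'cV[R]_n -> \bar R)
    (w : 'cV[R]_n) : \bar R :=
  ereal_sup [set ((dot w x)%:E - H x)%E | x in [set: 'cV[R]_n]].

Definition minimizer (R : realType) (T : Type) (f : T -> \bar R) (x : T) : Prop :=
  forall z, (f x <= f z)%E.

(* A chosen minimizer (an arbitrary point if there is none). *)
Definition argmin (R : realType) (n : nat) (f : 'cV[R]_n -> \bar R) : 'cV[R]_n :=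
  get [set x | minimizer f x].

(* For G proper, lower semicontinuous and convex the minimizer exists and is
   unique, so the choice made by argmin is immaterial. *)
Definition prox (R : realType) (n : nat) (G : 'cV[R]_n -> \bar R)
    (u : 'cV[R]_n) : 'cV[R]_n :=
  argmin (fun w => (G w + (2^-1 * enorm (w - u) ^+ 2)%:E)%E).

Definition variational_solution (R : realType) (p d m : nat)
    (K : 'M[R]_(p, d)) (A : 'M[R]_(m, d)) (y : 'cV[R]_p)
    (H : 'cV[R]_m -> \bar R) (x : 'cV[R]_d) (w : 'cV[R]_m) : Prop :=
  K^T *m (y - K *m x) - A^T *m w = 0 /\
  w = prox (convex_conjugate H) (w + A *m x).

Definition primal_dual_step (R : realType) (p d m : nat)
    (K : 'M[R]_(p, d)) (A : 'M[R]_(m, d)) (y : 'cV[R]_p)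
    (H : 'cV[R]_m -> \bar R) (z : 'cV[R]_d * 'cV[R]_m) : 'cV[R]_d * 'cV[R]_m :=
  let: (x, w) := z in
  let xbar := x + K^T *m (y - K *m x) - A^T *m w in
  let w' := prox (convex_conjugate H) (w + A *m xbar) in
  let x' := x + K^T *m (y - K *m x) - A^T *m w' in
  (x', w').

Definition primal_dual_seq (R : realType) (p d m : nat)
    (K : 'M[R]_(p, d)) (A : 'M[R]_(m, d)) (y : 'cV[R]_p)
    (H : 'cV[R]_m -> \bar R) (x0 : 'cV[R]_d) (w0 : 'cV[R]_m) (n : nat) :
    'cV[R]_d * 'cV[R]_m :=
  iter n (primal_dual_step K A y H) (x0, w0).

(* u_1, ..., u_N, without u_0; only used for 1 <= N. *)
Definition average (R : realType) (n : nat) (u : nat -> 'cV[R]_n) (N : nat) :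
    'cV[R]_n :=
  N%:R^-1 *: \sum_(1 <= i < N.+1) u i.

Definition primal_obj (R : realType) (p d m : nat)
    (K : 'M[R]_(p, d)) (A : 'M[R]_(m, d)) (y : 'cV[R]_p)
    (H : 'cV[R]_m -> \bar R) (x : 'cV[R]_d) : \bar R :=
  ((2^-1 * enorm (K *m x - y) ^+ 2)%:E + H (A *m x)%R)%E.

Definition saddle_obj (R : realType) (p d m : nat)
    (K : 'M[R]_(p, d)) (A : 'M[R]_(m, d)) (y : 'cV[R]_p)
    (H : 'cV[R]_m -> \bar R) (x : 'cV[R]_d) (w : 'cV[R]_m) : \bar R :=
  ((2^-1 * enorm (K *m x - y) ^+ 2 + dot (A *m x) w)%:E - convex_conjugate H w)%E.

Definition saddle_point (R : realType) (X W : Type) (F : X -> W -> \bar R)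
    (xd : X) (wd : W) : Prop :=
  forall x w, (F xd w <= F xd wd)%E /\ (F xd wd <= F x wd)%E.

(* The difference of extended reals follows the convention (-oo) - (-oo) = -oo
   and +oo - +oo = -oo. *)
Definition gap (R : realType) (X W : Type) (F : X -> W -> \bar R)
    (xd : X) (wd : W) (x : X) (w : W) : \bar R :=
  (F x wd - F xd w)%E.

(* Main.v *)
(* With the metric Q(x, w) = |x|^2 + |w|^2 - |A^T w|^2 (positive definite since
   |A| < 1), expanding one step of the iteration against any (x, w) gives
     2 (F(x_{n+1}, w) - F(x, w_{n+1}))
       <= Q(z_n - z) - Q(z_{n+1} - z)
          - |dx|^2 + |K dx|^2 - |K (x - x_n)|^2 - Q(0, dw),
   where z = (x, w), dx = x_{n+1} - x_n, dw = w_{n+1} - w_n. If (x, w) solves (V),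
   the left-hand side is at least |K (x_{n+1} - x)|^2, and the parallelogram law
   turns the K-terms into |K dx|^2 / 2 <= (|K|^2 / 2) |dx|^2. As |K|^2 < 2, the
   distance to any solution decreases by a multiple of |dx|^2 + |dw|^2 at each
   step. Hence the increments are square summable, every cluster point solves
   (V) because prox is nonexpansive, and the sequence converges to it.
   Summing the inequality and using convexity gives the ergodic bound, with
   C_1 bounding the sum of |K dx|^2 - |dx|^2, which is nonpositive if |K| <= 1.
   The statements about the primal objective calF follow from Fenchel-Moreau,
   calF(x) = sup_w F(x, w). *)
Require Import Defs.
From HB Require Import structures.
From mathcomp Require Import all_boot all_order all_algebra.
From mathcomp Require Import all_classical all_reals all_analysis.
From mathcomp Require Import ring lra.

Set Implicit Arguments.
Unset Strict Implicit.
Unset Printing Implicit Defensive.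

Import Order.TTheory GRing.Theory Num.Theory.
Import numFieldNormedType.Exports.

Local Open Scope classical_set_scope.
Local Open Scope ring_scope.

(** * Euclidean inner product and elementary inequalities *)

Section InnerProduct.
Variables (R : realType) (n : nat).
Implicit Types (u v w : 'cV[R]_n) (a : R).

Lemma dotC u v : dot u v = dot v u.
Proof. by apply: eq_bigr => i _; rewrite mulrC. Qed.

Lemma dotDl u v w : dot (u + v) w = dot u w + dot v w.
Proof. by rewrite -big_split; apply: eq_bigr => i _; rewrite !mxE mulrDl. Qed.

Lemma dotZl a u v : dot (a *: u) v = a * dot u v.
Proof. by rewrite mulr_sumr; apply: eq_bigr => i _; rewrite !mxE mulrA. Qed.

Lemma dotNl u v : dot (- u) v = - dot u v.
Proof. by rewrite -scaleN1r dotZl mulN1r. Qed.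

Lemma dotDr u v w : dot u (v + w) = dot u v + dot u w.
Proof. by rewrite dotC dotDl !(dotC u). Qed.

Lemma dotZr a u v : dot u (a *: v) = a * dot u v.
Proof. by rewrite dotC dotZl dotC. Qed.

Lemma dotNr u v : dot u (- v) = - dot u v.
Proof. by rewrite dotC dotNl dotC. Qed.

Lemma dot0l u : dot 0 u = 0.
Proof. by rewrite -(scale0r 0) dotZl mul0r. Qed.

Definition dotE := (dotDl, dotDr, dotNl, dotNr, dotZl, dotZr).

Lemma dot_suml (I : Type) (r : seq I) (F : I -> 'cV[R]_n) v :
  dot (\sum_(i <- r) F i) v = \sum_(i <- r) dot (F i) v.
Proof.
elim: r => [|i r IH]; first by rewrite !big_nil dot0l.
by rewrite !big_cons dotDl IH.
Qed.

Lemma dot_ge0 u : 0 <= dot u u.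
Proof. by apply: sumr_ge0 => i _; rewrite -expr2 sqr_ge0. Qed.

Lemma le_sqr_dot u i : u i 0 ^+ 2 <= dot u u.
Proof.
rewrite /dot (bigD1 i)//= -expr2 lerDl.
by apply: sumr_ge0 => j _; rewrite -expr2 sqr_ge0.
Qed.

Lemma dot_eq0 u : dot u u <= 0 -> u = 0.
Proof.
move=> u0; apply/colP => i; rewrite mxE; apply/eqP.
by rewrite -sqrf_eq0 -[_ == 0]andbT eq_le sqr_ge0 !andbT (le_trans (le_sqr_dot u i)).
Qed.

Lemma enorm_ge0 u : 0 <= enorm u.
Proof. exact: sqrtr_ge0. Qed.

Lemma sqr_enorm u : enorm u ^+ 2 = dot u u.
Proof. exact/sqr_sqrtr/dot_ge0. Qed.

Lemma enormZ a u : enorm (a *: u) = `|a| * enorm u.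
Proof. by rewrite /enorm dotZl dotZr mulrA -expr2 sqrtrM ?sqr_ge0// sqrtr_sqr. Qed.

(** Expand |a u + v|^2 >= 0 and |a u - v|^2 >= 0, then divide by a. *)
Lemma dot_young a u v : 0 < a -> 2 * `|dot u v| <= a * dot u u + a^-1 * dot v v.
Proof.
move=> a0.
have := dot_ge0 (a *: u - v); have := dot_ge0 (a *: u + v).
rewrite !dotE (dotC v u) => p m.
rewrite -(ler_pM2l a0) mulrDr !mulrA divff ?gt_eqF// mul1r.
by case: (ger0P (dot u v)) => _; nra.
Qed.

(** The squared norm of |v|^2 u - <u, v> v equals |v|^2 (|u|^2 |v|^2 - <u, v>^2). *)
Lemma dot_cauchy_schwarz u v : dot u v ^+ 2 <= dot u u * dot v v.
Proof.
have [/dot_eq0 ->|v0] := leP (dot v v) 0; first by rewrite !(dotC _ 0) !dot0l mulr0 expr0n.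
have := dot_ge0 (dot v v *: u - dot u v *: v).
rewrite !dotE (dotC v u) => h.
have : 0 <= dot v v * (dot u u * dot v v - dot u v ^+ 2) by nra.
by rewrite pmulr_rge0// subr_ge0.
Qed.

Lemma enormD u v : enorm (u + v) <= enorm u + enorm v.
Proof.
rewrite -(ler_pXn2r (ltn0Sn 1)) ?nnegrE ?addr_ge0 ?enorm_ge0//.
have : dot u v <= enorm u * enorm v.
  rewrite (le_trans (ler_norm _))//.
  rewrite -(ler_pXn2r (ltn0Sn 1)) ?nnegrE ?mulr_ge0 ?enorm_ge0//.
  by rewrite exprMn !sqr_enorm real_normK ?num_real// dot_cauchy_schwarz.
rewrite sqrrD !sqr_enorm !dotE (dotC v u); lra.
Qed.

Lemma enormN u : enorm (- u) = enorm u.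
Proof. by rewrite /enorm dotNl dotNr opprK. Qed.

Lemma dot_sum4 u v w z : dot (u + v + w + z) (u + v + w + z) <=
  4 * (dot u u + dot v v + dot w w + dot z z).
Proof.
have := dot_ge0 (u - v); have := dot_ge0 (u - w); have := dot_ge0 (u - z).
have := dot_ge0 (v - w); have := dot_ge0 (v - z); have := dot_ge0 (w - z).
rewrite !dotE (dotC v u) (dotC w u) (dotC z u) (dotC w v) (dotC z v) (dotC z w).
lra.
Qed.

Lemma dot_sum2 u v : dot (u + v) (u + v) <= 2 * (dot u u + dot v v).
Proof. by have := dot_ge0 (u - v); rewrite !dotE (dotC v u); lra. Qed.

(** Continuity of <u, .> at 0. Young's inequality with a = e / (|u|^2 + 1) makes both terms on its
    right smaller than e. *)
Lemma dot_small u (e : R) : 0 < e ->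
  exists2 d, 0 < d & forall v, dot v v < d -> `|dot u v| < e.
Proof.
move=> e0; pose a := e / (dot u u + 1).
have u1 : 0 < dot u u + 1 by have := dot_ge0 u; lra.
have a0 : 0 < a by rewrite divr_gt0.
exists (a * e); first by rewrite mulr_gt0.
move=> v ve; have := dot_young u v a0.
have : a^-1 * dot v v < e by rewrite mulrC ltr_pdivrMr// mulrC.
have : a * dot u u < e.
  by rewrite mulrAC ltr_pdivrMr// ltr_pM2l// ltrDl.
lra.
Qed.

End InnerProduct.

Lemma exists_small (R : realType) (e M : R) : 0 < e ->
  exists2 t, 0 < t <= 1 & t * M < e.
Proof.
move=> e0; have M0 := normr_ge0 M; have M1 : 0 < e + `|M| by lra.
exists (e / (e + `|M|)).
  by rewrite divr_gt0//= ler_pdivrMr// mul1r; lra.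
rewrite mulrAC ltr_pdivrMr// ltr_pM2l//.
by have := ler_norm M; lra.
Qed.

(** * Adjoints and operator norm bounds *)

Section OperatorNorm.
Variables (R : realType) (m n : nat).
Implicit Types (M : 'M[R]_(m, n)).

Lemma dot_mulmx M (u : 'cV[R]_n) (v : 'cV[R]_m) :
  dot (M *m u) v = dot u (M^T *m v).
Proof.
transitivity ((u^T *m M^T *m v) 0 0).
  by rewrite -trmx_mul mxE; apply: eq_bigr => i _; rewrite !mxE.
by rewrite -mulmxA mxE; apply: eq_bigr => i _; rewrite !mxE.
Qed.

Lemma opnorm_has_sup M :
  has_sup [set enorm (M *m x) | x in [set x : 'cV[R]_n | enorm x <= 1]].
Proof.
split.
  by exists (enorm (M *m 0)), 0 => //=; rewrite /enorm dot0l sqrtr0 ler01.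
(* The Frobenius norm is an upper bound, by Cauchy-Schwarz on each row. *)
exists (Num.sqrt (\sum_i dot (row i M)^T (row i M)^T)) => _ [x /= x1 <-].
rewrite ler_wsqrtr//; apply: ler_sum => i _.
have -> : (M *m x) i 0 = dot (row i M)^T x.
  by rewrite mxE; apply: eq_bigr => j _; rewrite !mxE.
rewrite -expr2 (le_trans (dot_cauchy_schwarz _ _))// ler_piMr ?dot_ge0//.
by rewrite -sqr_enorm expr_le1// enorm_ge0.
Qed.

Lemma opnorm_ge0 M : 0 <= opnorm M.
Proof.
apply: (le_trans (enorm_ge0 (M *m 0))).
apply: (sup_upper_bound (opnorm_has_sup M)).
by exists 0 => //=; rewrite /enorm dot0l sqrtr0 ler01.
Qed.

Lemma enorm_mulmx_le M x : enorm (M *m x) <= opnorm M * enorm x.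
Proof.
have [x0|x0] := leP (enorm x) 0.
  have -> : x = 0 by apply: dot_eq0; rewrite -sqr_enorm; have := enorm_ge0 x; nra.
  by rewrite mulmx0 /enorm !dot0l sqrtr0 mulr0.
rewrite -ler_pdivrMr// mulrC -[(enorm x)^-1]gtr0_norm ?invr_gt0// -enormZ scalemxAr.
apply: (sup_upper_bound (opnorm_has_sup M)).
exists ((enorm x)^-1 *: x) => //=.
by rewrite enormZ gtr0_norm ?invr_gt0// mulVf ?gt_eqF.
Qed.

Lemma dot_mulmx_le M x : dot (M *m x) (M *m x) <= opnorm M ^+ 2 * dot x x.
Proof.
rewrite -!sqr_enorm -exprMn lerXn2r ?nnegrE ?enorm_ge0//.
  by rewrite mulr_ge0 ?opnorm_ge0 ?enorm_ge0.
exact: enorm_mulmx_le.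
Qed.

(** With s = |M^T v|^2 = <M M^T v, v>, Cauchy-Schwarz gives s^2 <= |M|^2 s |v|^2, and s cancels. *)
Lemma dot_trmx_mulmx_le M (v : 'cV[R]_m) :
  dot (M^T *m v) (M^T *m v) <= opnorm M ^+ 2 * dot v v.
Proof.
set s := dot (M^T *m v) _.
have sE : s = dot (M *m (M^T *m v)) v by rewrite dot_mulmx.
have := dot_cauchy_schwarz (M *m (M^T *m v)) v; rewrite -sE => cs.
have := dot_mulmx_le M (M^T *m v); rewrite -/s => le1.
have s0 : 0 <= s by exact: dot_ge0.
have [s1|s1] := leP s 0.
  by apply: le_trans s1 _; rewrite mulr_ge0 ?sqr_ge0 ?dot_ge0.
rewrite -(ler_pM2l s1) -expr2 (le_trans cs)//.
by rewrite [leRHS]mulrA (mulrC s) ler_wpM2r ?dot_ge0.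
Qed.

End OperatorNorm.

(** * Compactness and convergence in terms of squared Euclidean distances *)

Section Topology.
Variable R : realType.

Lemma dot_le_entries n (v : 'cV[R]_n) (e : R) :
  (forall i, `|v i 0| <= e) -> dot v v <= n%:R * e ^+ 2.
Proof.
move=> ve; rewrite -[n in n%:R]card_ord -sum1_card natr_sum mulr_suml.
apply: ler_sum => i _; rewrite mul1r -expr2 -[leLHS]real_normK ?num_real//.
by rewrite lerXn2r ?nnegrE ?(le_trans _ (ve i)).
Qed.

Lemma dot_lt_entries n (v : 'cV[R]_n) (e : R) i :
  0 < e -> dot v v < e ^+ 2 -> `|v i 0| < e.
Proof.
move=> e0 ve; rewrite -(ltr_pXn2r (ltn0Sn 1)) ?nnegrE ?(ltW e0)//.
by rewrite real_normK ?num_real// (le_lt_trans (le_sqr_dot v i)).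
Qed.

(** Bolzano-Weierstrass, from compactness of a box of row vectors; [b] is [M + 1] because then M <
    b^2, so every entry lies in [-b, b]. *)
Lemma bounded_seq_cluster n (u : nat -> 'cV[R]_n) (M : R) :
  (forall k, dot (u k) (u k) <= M) ->
  exists l, forall (e : R) N, 0 < e ->
    exists2 k, (N <= k)%N & dot (u k - l) (u k - l) < e.
Proof.
move=> uM; pose b := M + 1.
have M0 : 0 <= M by apply: le_trans (uM 0%N); exact: dot_ge0.
have cK : compact [set v : 'rV[R]_n | forall i, `[- b, b]%classic (v ord0 i)].
  by apply: (@rV_compact R n (fun=> `[- b, b]%classic)) => _; exact: segment_compact.
have [|l [_ lc]] := cK ((fun k => (u k)^T) @ \oo) _.
  exists 0%N => // k _ i /=; rewrite mxE in_itv/= -ler_norml.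
  have := dot_lt_entries i (_ : 0 < b) (_ : _ < b ^+ 2).
  move=> /(_ (u k)) h; apply/ltW/h; rewrite /b; first lra.
  by have := uM k; nra.
exists l^T => e N e0.
have n0 : 0 <= n%:R :> R by [].
(* Entries within t <= 1 of the limit give a squared distance of at most n t^2 <= n t < e. *)
have [t /andP[t0 t1] te] := exists_small (n%:R : R) e0.
have [||_ [[k Nk <-]] h] := lc [set (u k)^T | k in [set k | (N <= k)%N]] (ball l t).
- by exists N => // k Nk /=; exists k.
- exact: nbhsx_ballx.
exists k => //; apply: le_lt_trans te.
case: h => _ /(_ 0) h.
apply: (le_trans (@dot_le_entries n _ t _)).
  by move=> i; have := h i; rewrite /ball/= !mxE distrC => /ltW.
have : 0 <= n%:R * (t * (1 - t)) by rewrite !mulr_ge0// ?subr_ge0// ltW.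
lra.
Qed.

Lemma cvg_cV n (u : nat -> 'cV[R]_n) l :
  (forall e : R, 0 < e -> exists N, forall k, (N <= k)%N -> dot (u k - l) (u k - l) < e) ->
  u @ \oo --> l.
Proof.
move=> ul; apply/cvg_ballP => e e0.
have [N h] := ul _ (exprn_gt0 2 e0).
exists N => // k /= Nk; split => // i j.
rewrite ord1 /ball/= distrC.
by have := dot_lt_entries i e0 (h k Nk); rewrite !mxE.
Qed.

Lemma nbhs_dot n (x : 'cV[R]_n) (V : set 'cV[R]_n) : nbhs x V ->
  exists2 e : R, 0 < e & forall y, dot (y - x) (y - x) < e -> V y.
Proof.
move=> /nbhs_ballP[e /= e0 xV]; exists (e ^+ 2); first exact: exprn_gt0.
move=> y yx; apply: xV; split => // i j; rewrite ord1 /ball/= distrC.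
by have := dot_lt_entries i e0 yx; rewrite !mxE.
Qed.

Lemma cvg_average n (u : nat -> 'cV[R]_n) (l : 'cV[R]_n) :
  u @ \oo --> l -> average u @ \oo --> l.
Proof.
move=> ul.
have ulE i : (fun k => u k i 0) @ \oo --> l i 0.
  exact: (cvg_comp _ _ ul (@coord_continuous _ _ _ i 0 l)).
have h i : (fun N => average u N i 0) @ \oo --> l i 0.
  (* The averages start at [u 1], so the Cesaro theorem is applied to the shifted sequence. *)
  have ulS : (fun k => u k.+1 i 0) @ \oo --> l i 0.
    by have := ulE i; rewrite -(cvg_shiftS (fun k => u k i 0)).
  rewrite -cvg_shiftS; move/cesaro: ulS.
  apply: cvg_trans; apply: near_eq_cvg; near=> N.
  by rewrite /= mxE summxE big_add1.
apply/cvg_ballP => e e0.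
have := @filter_forall _ _ (fun i N => ball (l i 0) e (average u N i 0)) \oo _.
case=> [i|N _ hN]; first by move/cvg_ballP : (h i); exact.
by exists N => // k /= Nk; split => // i j; rewrite ord1; exact: hN.
Unshelve. all: by end_near. Qed.

End Topology.

(** * Lower semicontinuous convex functions, proximal points, affine minorants *)

Section ClosedConvex.
Variables (R : realType) (n : nat).
Implicit Types (G : 'cV[R]_n -> \bar R) (x y z u v w : 'cV[R]_n) (a b c r : R).

Definition dot_lsc G := forall x a, (a%:E < G x)%E ->
  exists2 e, 0 < e & forall y, dot (y - x) (y - x) < e -> (a%:E < G y)%E.

(* [econvex] without products of extended reals. *)
Definition fin_convex G := forall x y a b t, 0 <= t <= 1 ->
  (G x <= a%:E)%E -> (G y <= b%:E)%E ->
  (G (t *: x + (1 - t) *: y)%R <= (t * a + (1 - t) * b)%:E)%E.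

Lemma lower_semicontinuous_dot G : lower_semicontinuous G -> dot_lsc G.
Proof.
by move=> Glsc x a /Glsc[V /nbhs_dot[e e0 eV] Va]; exists e => // y /eV /Va.
Qed.

Lemma econvex_fin G : econvex G -> fin_convex G.
Proof.
move=> Gc x y a b t t01 Gx Gy; have /andP[t0 t1] := t01.
apply: le_trans (Gc x y t t01) _.
by rewrite (EFinD (t * a)) !EFinM leeD// lee_wpmul2l// lee_fin ?subr_ge0.
Qed.

(** Compactness step behind [lsc_min_ball]. A cluster point of the chosen points stays in the ball,
    and lower semicontinuity passes eventual bounds on [c] to it. *)
Lemma lsc_ball_cluster G z r (c : nat -> R) : dot_lsc G ->
  (forall k, exists2 x, dot (x - z) (x - z) <= r & (G x <= (c k)%:E)%E) ->
  exists2 l, dot (l - z) (l - z) <= r &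
    forall a N, (forall k, (N <= k)%N -> c k <= a) -> (G l <= a%:E)%E.
Proof.
move=> Glsc xP; have /choice[u uP] : forall k, exists x,
    dot (x - z) (x - z) <= r /\ (G x <= (c k)%:E)%E.
  by move=> k; have [x] := xP k; exists x.
have ur k : dot (u k - z) (u k - z) <= r by have [] := uP k.
have [l0 lP] := bounded_seq_cluster ur.
pose l := z + l0.
have lu k : u k - z - l0 = u k - l by rewrite /l opprD addrA.
exists l; last first.
  move=> a N Na; rewrite leNgt; apply/negP => /Glsc[e e0 eG].
  have [k Nk] := lP e N e0; rewrite lu => /eG.
  by have [_ ck] := uP k; rewrite ltNge (le_trans ck)// lee_fin Na.
(* Closedness of the ball: if |l0|^2 > r, then u_k - z close to l0 has <l0, u_k - z - l0> > -(|l0|^2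
   - r) / 2, which forces |u_k - z|^2 > r. *)
rewrite leNgt; apply/negP => rl; rewrite /l addrAC subrr add0r in rl.
have e0 : 0 < (dot l0 l0 - r) / 2 by lra.
have [d d0 ld] := dot_small l0 e0.
have [k _ kd] := lP d 0%N d0.
have := ur k; rewrite -(subrK l0 (u k - z)).
rewrite dotDl !(dotDr _ _ l0) (dotC _ l0).
have := ld _ kd; rewrite ltr_norml => /andP[h _].
have := dot_ge0 (u k - z - l0); lra.
Qed.

Lemma lsc_min_ball G z r x1 : dot_lsc G -> (forall x, G x != -oo%E) ->
  dot (x1 - z) (x1 - z) <= r ->
  exists2 l, dot (l - z) (l - z) <= r &
    forall x, dot (x - z) (x - z) <= r -> (G l <= G x)%E.
Proof.
move=> Glsc GNoo x1r.
pose S := [set c | exists2 x, dot (x - z) (x - z) <= r & (G x <= c%:E)%E].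
have [S0|/set0P S0] := eqVneq S set0.
  exists x1 => // x xr; suff -> : G x = +oo%E by rewrite leey.
  case Gx : (G x) => [g|//|]; last by have := GNoo x; rewrite Gx.
  have : S g by exists x => //; rewrite Gx.
  by rewrite S0.
(* If [S] had no lower bound, the levels -k would produce a point where [G] is -oo. *)
have Slb : has_lbound S.
  apply: contrapT => Sunb.
  have [|l _ lP] := @lsc_ball_cluster G z r (fun k => - k%:R) Glsc.
    move=> k; apply: contrapT => nk; apply: Sunb; exists (- k%:R) => c [x xr xc].
    rewrite leNgt; apply/negP => ck; apply: nk; exists x => //.
    by rewrite (le_trans xc)// lee_fin ltW.
  have lN a : (G l <= a%:E)%E.
    apply: (lP a (Num.bound `|a|)) => k ak.
    have := archi_boundP (normr_ge0 a).
    have : (Num.bound `|a|)%:R <= k%:R :> R by rewrite ler_nat.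
    have := ler_norm (- a); rewrite normrN; lra.
  case Gl : (G l) (GNoo l) => [g||]// _.
    by have := lN (g - 1); rewrite Gl lee_fin; lra.
  by have := lN 0; rewrite Gl.
(* A minimizing sequence, with levels inf S + 1 / (k + 1). *)
have [|l lr lP] := @lsc_ball_cluster G z r (fun k => inf S + k.+1%:R^-1) Glsc.
  move=> k; have k0 : 0 < k.+1%:R^-1 :> R by rewrite invr_gt0.
  have [c [x xr xc] ck] := inf_adherent k0 (conj S0 Slb).
  by exists x => //; rewrite (le_trans xc)// lee_fin ltW.
exists l => // x xr; case Gx : (G x) (GNoo x) => [g||]// _; last by rewrite leey.
apply/lee_addgt0Pr => e e0; rewrite -EFinD.
apply: (lP _ (Num.bound e^-1)) => k ek; apply: lerD.
  by apply: ge_inf => //; exists x => //; rewrite Gx.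
have ei0 : 0 < e^-1 by rewrite invr_gt0.
rewrite -[e]invrK lef_pV2 ?posrE//.
have := archi_boundP (ltW ei0).
have : (Num.bound e^-1)%:R <= k.+1%:R :> R by rewrite ler_nat leqW.
lra.
Qed.

(** The quadratic term lies above its linearization at x, so only the linear term 2 c <x - z, y - x>
    has to be kept small near x. *)
Lemma dot_lscD_sqr G z c : 0 <= c -> dot_lsc G ->
  dot_lsc (fun x => (G x + (c * dot (x - z) (x - z))%:E)%E).
Proof.
move=> c0 Glsc x a aG.
set q := c * dot (x - z) (x - z) in aG.
have [b ab bG] : exists2 b, a - q < b & (b%:E < G x)%E.
  case: (G x) aG => [g||].
  - rewrite -EFinD lte_fin => aG; exists ((a - q + g) / 2); rewrite ?lte_fin; lra.
  - by move=> _; exists (a - q + 1); rewrite ?ltry//; lra.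
  - by [].
have [e1 e10 eG] := Glsc _ _ bG.
have [|d d0 xd] := @dot_small _ _ (2 * c *: (x - z)) (b - (a - q)); first by lra.
exists (Num.min e1 d); first by rewrite lt_min e10.
move=> y; rewrite lt_min => /andP[/eG by_ /xd yd].
apply: (@lt_le_trans _ _ (b%:E + (c * dot (y - z) (y - z))%:E)%E); last first.
  by rewrite leeD2r// ltW.
rewrite -EFinD lte_fin.
have -> : y - z = (x - z) + (y - x) by rewrite [RHS]addrC addrA subrK.
rewrite !dotE -/q.
move: yd; rewrite ltr_norml dotZl => /andP[yd _].
have : 0 <= c * dot (y - x) (y - x) by rewrite mulr_ge0 ?dot_ge0.
move: yd ab; rewrite /q !dotE (dotC z x) (dotC y x) (dotC y z).
lra.
Qed.

(* For small enough [l] the minimizer of [G x + |x - z|^2 / (2 l)] over the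
   ball lies in its interior, so that no global lower bound on [G] is needed. *)
Lemma proximal_point_ball G z r b x1 h1 l :
  dot_lsc G -> (forall x, G x != -oo%E) -> fin_convex G ->
  (forall x, dot (x - z) (x - z) <= r -> (b%:E <= G x)%E) ->
  (G x1 <= h1%:E)%E -> 0 < l -> dot (x1 - z) (x1 - z) <= r ->
  dot (x1 - z) (x1 - z) + 2 * l * (h1 - b) < r ->
  exists q g, [/\ dot (q - z) (q - z) < r, G q = g%:E &
    forall x, ((g + l^-1 * dot (z - q) (x - q))%:E <= G x)%E].
Proof.
move=> Glsc GNoo Gcvx Gb Gx1 l0 x1r lr.
pose c := (2 * l)^-1; have c0 : 0 < c by rewrite invr_gt0; lra.
have lc : l^-1 = 2 * c by rewrite /c invfM mulrA divff ?mul1r.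
pose G' x := (G x + (c * dot (x - z) (x - z))%:E)%E.
have G'lsc : dot_lsc G' by apply: dot_lscD_sqr => //; exact: ltW.
have G'Noo x : G' x != -oo%E by rewrite /G'; case: (G x) (GNoo x).
have [q qr qmin] := lsc_min_ball G'lsc G'Noo x1r.
have G'x1 := qmin _ x1r.
have [g Gq] : exists g, G q = g%:E.
  case Gq : (G q) (GNoo q) => [g||]// _; first by exists g.
  have : (G' x1 < +oo)%E.
    rewrite (@le_lt_trans _ _ (h1%:E + (c * dot (x1 - z) (x1 - z))%:E)%E)//.
      by rewrite leeD2r.
    by rewrite -EFinD ltry.
  by rewrite ltNge (le_trans _ G'x1)// /G' Gq.
(* Comparing the values at [q] and [x1], with b <= g, bounds |q - z|^2 by |x1 - z|^2 + 2 l (h1 - b)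
   < r. *)
have qr' : dot (q - z) (q - z) < r.
  have bg : b <= g by rewrite -lee_fin -Gq Gb.
  have : g + c * dot (q - z) (q - z) <= h1 + c * dot (x1 - z) (x1 - z).
    rewrite -lee_fin !EFinD -Gq (le_trans G'x1)// leeD2r//.
  have cl : c * (2 * l) = 1 by rewrite mulVf// mulf_neq0 ?gt_eqF.
  have : c * (dot (x1 - z) (x1 - z) + 2 * l * (h1 - b)) < c * r by rewrite ltr_pM2l.
  rewrite mulrDr mulrA cl mul1r => h h'.
  by rewrite -(ltr_pM2l c0); lra.
exists q, g; split => // x.
case Gx : (G x) (GNoo x) => [a||]// _; last by rewrite leey.
rewrite lee_fin leNgt; apply/negP => ag; rewrite lc in ag.
pose D := dot (q - z) (x - q); pose E := dot (x - q) (x - q).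
have E0 : 0 <= E := dot_ge0 _.
have DE : dot (z - q) (x - q) = - D by rewrite /D -dotNl opprB.
rewrite DE in ag.
(* A short move from [q] towards [x]: the first bound on t keeps it inside the ball, the second
   makes the objective drop below its minimum. *)
have [|t /andP[t0 t1]] := @exists_small _
    (Num.min (r - dot (q - z) (q - z)) (g - 2 * c * D - a))
    (2 * `|D| + E + c * E).
  by rewrite lt_min; apply/andP; split; lra.
rewrite lt_min => /andP[tr tg].
pose xt := t *: x + (1 - t) *: q.
have xtE : xt - z = (q - z) + t *: (x - q).
  by apply/colP => i; rewrite !mxE; ring.
have tE : t * (t * E) <= t * E by rewrite ler_piMl// mulr_ge0// ltW.
have tD : t * D <= t * `|D| by rewrite ler_wpM2l ?ler_norm// ltW.
have ctE : 0 <= t * (c * E) by rewrite mulr_ge0 ?mulr_ge0// ltW.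
have tD0 : 0 <= t * `|D| by rewrite mulr_ge0// ltW.
have xtN : dot (xt - z) (xt - z) = dot (q - z) (q - z) + 2 * (t * D) + t * (t * E).
  rewrite xtE dotDl !(dotDr _ _ (t *: _)) !dotZl !dotZr (dotC (x - q) (q - z)).
  by rewrite -/D -/E; ring.
have xtr : dot (xt - z) (xt - z) <= r by rewrite xtN; lra.
have t01 : 0 <= t <= 1 by rewrite ltW.
have Gxt := Gcvx x q a g t t01; rewrite Gx Gq -/xt in Gxt.
have := le_trans (qmin _ xtr) (leeD2r _ (Gxt (lexx _) (lexx _))).
rewrite /G' Gq -!EFinD lee_fin xtN.
have tE0 : 0 <= t * E by rewrite mulr_ge0// ltW.
move=> h.
have : 0 <= t * (a - g + 2 * c * D + c * (t * E)).
  by move: h; rewrite !mulrDr; lra.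
rewrite pmulr_rge0//; lra.
Qed.

(* Fenchel-Moreau: the proximal points of [z] with small parameter provide
   affine minorants that come arbitrarily close to [G z]. *)
Lemma affine_minorant G z a :
  dot_lsc G -> eproper G -> fin_convex G -> (a%:E < G z)%E ->
  exists w, forall x, ((a + dot w (x - z))%:E <= G x)%E.
Proof.
move=> Glsc [GNoo [x1 x1oo]] Gcvx aGz.
case Gx1 : (G x1) x1oo (GNoo x1) => [h1||]// _ _.
pose r := dot (x1 - z) (x1 - z) + 1.
have x1r : dot (x1 - z) (x1 - z) <= r by rewrite /r; lra.
have [xm xmr xmin] := lsc_min_ball Glsc GNoo x1r.
case Gxm : (G xm) (GNoo xm) (xmin _ x1r) => [b||]// _; last by rewrite Gx1.
rewrite Gx1 lee_fin => bh.
have [d d0 dG] := Glsc _ _ aGz.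
(* The bound 1 yields the interiority condition, as r exceeds |x1 - z|^2 by 1; the bound d yields l
   |a - b| < d. *)
have [|l /andP[l0 l1]] := @exists_small _ (Num.min 1 d) (2 * (h1 - b) + `|a - b|).
  by rewrite lt_min ltr01.
rewrite lt_min => /andP[lh la].
have lb0 : 0 <= l * (h1 - b) by rewrite mulr_ge0 ?subr_ge0// ltW.
have la0 : 0 <= l * `|a - b| by rewrite mulr_ge0// ltW.
have [|||||q [g [qr Gq qG]]] := @proximal_point_ball G z r b x1 h1 l Glsc GNoo Gcvx.
- by move=> x xr; rewrite -Gxm xmin.
- by rewrite Gx1.
- exact: l0.
- exact: x1r.
- by rewrite /r; lra.
exists (l^-1 *: (z - q)) => x; apply: le_trans (qG x).
rewrite lee_fin dotZl.
have -> : dot (z - q) (x - z) = dot (z - q) (x - q) - dot (z - q) (z - q).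
  by rewrite -dotNr -dotDr opprB addrA subrK.
rewrite mulrBr.
have li0 : 0 < l^-1 by rewrite invr_gt0.
have zq0 := dot_ge0 (z - q).
have lzq0 : 0 <= l^-1 * dot (z - q) (z - q) by rewrite mulr_ge0// ltW.
(* What remains is a <= g + |z - q|^2 / l. Near z, lower semicontinuity gives a < g; away from z,
   the quadratic term is at least |a - b| and g >= b. *)
have [qd|qd] := ltP (dot (q - z) (q - z)) d.
  have := dG _ qd; rewrite Gq lte_fin; lra.
have bg : b <= g by rewrite -lee_fin -Gq -Gxm xmin// ltW.
have zqd : d <= dot (z - q) (z - q) by rewrite -opprB dotNl dotNr opprK.
have : l^-1 * (l * `|a - b|) <= l^-1 * dot (z - q) (z - q).
  by rewrite ler_pM2l//; lra.
rewrite mulrA mulVf ?gt_eqF// mul1r.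
have := ler_norm (a - b); lra.
Qed.

(** The hypothesis makes u - q a subgradient at q, so the prox objective exceeds its value at q by
    at least |w - q|^2 / 2. Hence q is a minimizer and the one chosen by [argmin] coincides with
    it. *)
Lemma prox_unique G u q g : G q = g%:E ->
  (forall w, ((g + dot (u - q) (w - q))%:E <= G w)%E) -> prox G u = q.
Proof.
move=> Gq qG; pose f w := (G w + (2^-1 * enorm (w - u) ^+ 2)%:E)%E.
have fE w : f w = (G w + (2^-1 * dot (w - u) (w - u))%:E)%E.
  by rewrite /f sqr_enorm.
have key w : (f q + (2^-1 * dot (w - q) (w - q))%:E <= f w)%E.
  rewrite !fE Gq -!EFinD; apply: le_trans (leeD2r _ (qG w)).
  rewrite -EFinD lee_fin.
  have -> : w - u = (w - q) - (u - q) by rewrite opprB addrA subrK.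
  rewrite -(opprB u q) dotNl dotNr.
  rewrite [dot (_ - _ - _) _]dotDl !(dotDr _ (w - q) (- _)) !dotNl !dotNr.
  by rewrite (dotC (w - q) (u - q)); lra.
have qmin : minimizer f q.
  move=> w; apply: le_trans (key w); rewrite leeDl// lee_fin.
  by rewrite mulr_ge0 ?dot_ge0.
have /(_ q) fpq := getPex (ex_intro _ q qmin : [set x | minimizer f x] !=set0).
apply/eqP; rewrite -subr_eq0; apply/eqP/dot_eq0.
have := le_trans (key (prox G u)) fpq.
rewrite fE Gq -!EFinD lee_fin.
by rewrite -/(prox G u); lra.
Qed.

End ClosedConvex.

(** * Convex conjugate, biconjugation and its proximity operator *)

Section Conjugate.
Variables (R : realType) (n : nat) (H : 'cV[R]_n -> \bar R).
Hypothesis H_proper : eproper H.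
Local Notation H' := (convex_conjugate H).
Implicit Types (x u v w z : 'cV[R]_n).

(** Turns bounds on the conjugate into affine minorants of [H], free of suprema and extended
    subtraction. *)
Lemma conjugate_leP w (c : R) :
  (H' w <= c%:E)%E <-> forall x, ((dot w x - c)%:E <= H x)%E.
Proof.
have [HNoo _] := H_proper.
split=> [wc x|wc].
  have : ((dot w x)%:E - H x <= H' w)%E by apply: ereal_sup_ubound; exists x.
  move/le_trans => /(_ _ wc).
  case: (H x) (HNoo x) => [h||]// _; last by rewrite leey.
  by rewrite -EFinB !lee_fin; lra.
apply: ge_ereal_sup => _ [x _ <-].
have := wc x; case: (H x) (HNoo x) => [h||]// _; last by rewrite leNye.
by rewrite -EFinB !lee_fin; lra.
Qed.

Lemma conjugate_Noo w : H' w != -oo%E.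
Proof.
have [HNoo [x xoo]] := H_proper.
apply/eqP => w0.
have := (conjugate_leP w (dot w x - fine (H x) - 1)).1.
rewrite w0 leNye => /(_ isT x).
by case: (H x) xoo (HNoo x) => [h||]//= _ _; rewrite lee_fin; lra.
Qed.

Lemma conjugate_lsc : dot_lsc H'.
Proof.
have [HNoo _] := H_proper.
move=> w a; rewrite ltNge => /negP/conjugate_leP/existsNP[x].
case Hx : (H x) (HNoo x) => [h||]// _; last by rewrite leey.
rewrite lee_fin => /negP; rewrite -ltNge => hw.
have [|d d0 xd] := @dot_small _ _ x (dot w x - a - h); first by lra.
exists d => // v /xd; rewrite ltr_norml dotDr dotNr => /andP[h1 _].
rewrite ltNge; apply/negP => /conjugate_leP/(_ x); rewrite Hx lee_fin.
rewrite (dotC v x); rewrite (dotC w x) in hw h1; lra.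
Qed.

Lemma conjugate_convex : fin_convex H'.
Proof.
move=> x y a b t /andP[t0 t1] /conjugate_leP xa /conjugate_leP yb.
apply/conjugate_leP => z; have [HNoo _] := H_proper.
have := yb z; have := xa z.
case: (H z) (HNoo z) => [h||]// _; last by rewrite !leey.
rewrite !lee_fin !dotE => h1 h2.
have : t * (dot x z - a) <= t * h by rewrite ler_wpM2l.
have : (1 - t) * (dot y z - b) <= (1 - t) * h by rewrite ler_wpM2l// subr_ge0.
lra.
Qed.

(** Jensen's inequality: the average of affine minorants of [H] is again one. *)
Lemma conjugate_average (u : nat -> 'cV[R]_n) (h : nat -> R) N : (0 < N)%N ->
  (forall i, H' (u i) = (h i)%:E) ->
  (H' (N%:R^-1 *: \sum_(0 <= i < N) u i)%R <= (N%:R^-1 * \sum_(0 <= i < N) h i)%:E)%E.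
Proof.
move=> N0 uh; apply/conjugate_leP => x; have [HNoo _] := H_proper.
have ux i : ((dot (u i) x - h i)%:E <= H x)%E.
  by apply: (conjugate_leP (u i) (h i)).1; rewrite uh.
move: ux.
case: (H x) (HNoo x) => [c||]// _ hc; last by rewrite leey.
rewrite lee_fin dotZl dot_suml -mulrBr -sumrB mulrC ler_pdivrMr ?ltr0n//.
rewrite mulr_natr -{2}(subn0 N) -sumr_const_nat; apply: ler_sum => i _.
by have := hc i; rewrite lee_fin.
Qed.

Hypothesis H_lsc : dot_lsc H.
Hypothesis H_convex : fin_convex H.

(** An affine minorant with value a at z and slope w says exactly that the conjugate at w is at most
    <w, z> - a. *)
Lemma fenchel_moreau z (a : R) : (a%:E < H z)%E ->
  exists w c, H' w = c%:E /\ a <= dot w z - c.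
Proof.
move=> /(affine_minorant H_lsc H_proper H_convex)[w wH].
have : (H' w <= (dot w z - a)%:E)%E.
  apply/conjugate_leP => x; apply: le_trans (wH x).
  by rewrite lee_fin dotDr dotNr; lra.
case Hw : (H' w) (conjugate_Noo w) => [c||]// _; rewrite lee_fin => wc.
by exists w, c; split => //; lra.
Qed.

(** Existence of the prox point with its optimality condition. The parameter of
    [proximal_point_ball] is now fixed at 1, so the minimizer is made interior by a large radius
    instead. *)
Lemma conjugate_prox u : exists g, H' (prox H' u) = g%:E /\
  forall w, ((g + dot (u - prox H' u) (w - prox H' u))%:E <= H' w)%E.
Proof.
have [HNoo [v voo]] := H_proper.
case Hv : (H v) voo (HNoo v) => [h||]// _ _.
have [|w1 [h1 [Hw1 _]]] := @fenchel_moreau v (h - 1).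
  by rewrite Hv lte_fin; lra.
have H'v w : ((dot w v - h)%:E <= H' w)%E.
  case Hw : (H' w) (conjugate_Noo w) => [c||]// _; last by rewrite leey.
  have : (H' w <= c%:E)%E by rewrite Hw.
  by move=> /conjugate_leP/(_ v); rewrite Hv !lee_fin; lra.
pose B := dot u v - h - dot v v; pose D := dot (w1 - u) (w1 - u).
have D0 : 0 <= D := dot_ge0 _.
(* By Young with weight 1/2 the conjugate is at least B - r / 4 on the ball. Interiority then reads
   D + 2 (h1 - B) + r / 2 < r, which this r satisfies. *)
pose r := 2 * (D + 2 * `|h1 - B|) + 1.
have hB := ler_norm (h1 - B); have hB0 := normr_ge0 (h1 - B).
have [|||||q [g [_ Hq qH]]] := @proximal_point_ball R n H' u r (B - r / 4) w1 h1 1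
    conjugate_lsc conjugate_Noo conjugate_convex.
- move=> w wr; apply: le_trans (H'v w); rewrite lee_fin.
  have -> : dot w v = dot u v + dot (w - u) v by rewrite dotDl dotNl addrC subrK.
  have := dot_young (w - u) v (_ : 0 < 2^-1); rewrite invr_gt0 invrK => /(_ (ltr0n _ 2)).
  have := ler_norm (- dot (w - u) v); rewrite normrN /B; lra.
- by rewrite Hw1.
- exact: ltr01.
- by rewrite -/D /r; lra.
- by rewrite -/D /r; lra.
have qH' w : ((g + dot (u - q) (w - q))%:E <= H' w)%E.
  by have := qH w; rewrite invr1 mul1r.
by rewrite (prox_unique Hq qH'); exists g.
Qed.

(** Adding the two subgradient inequalities gives |p - q|^2 <= <u - v, p - q> for the prox points p
    and q; |u - v - (p - q)|^2 >= 0 does the rest. *)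
Lemma prox_nonexpansive u v : dot (prox H' u - prox H' v) (prox H' u - prox H' v) <=
  dot (u - v) (u - v).
Proof.
have [g [Hp pH]] := conjugate_prox u; have [h [Hq qH]] := conjugate_prox v.
have := pH (prox H' v); have := qH (prox H' u); rewrite Hp Hq !lee_fin.
set p := prox H' u; set q := prox H' v => h1 h2.
have := dot_ge0 (u - v - (p - q)).
move: h1 h2; rewrite !dotE.
rewrite (dotC q p) (dotC v u) (dotC p u) (dotC q u) (dotC p v) (dotC q v).
lra.
Qed.

End Conjugate.

Local Ltac col_ring := apply/colP => i; rewrite !mxE; ring.

(** * Estimates for a single primal-dual step *)

Section OneStep.
Variables (R : realType) (p d m : nat) (K : 'M[R]_(p, d)) (A : 'M[R]_(m, d)).
Variable (y : 'cV[R]_p).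
Implicit Types (x X : 'cV[R]_d) (w W : 'cV[R]_m) (h : R).

Definition metric x w : R := dot x x + dot w w - dot (A^T *m w) (A^T *m w).

(** The real-valued saddle function, where [h] stands for the finite value of the conjugate at [w];
    the estimates are thus algebra in [R]. *)
Definition lagrangian x w h : R :=
  2^-1 * dot (K *m x - y) (K *m x - y) + dot (A *m x) w - h.

Lemma dot_trmx_mulmx x (r : 'cV[R]_p) : dot (K^T *m r) x = dot r (K *m x).
Proof. by rewrite dotC -dot_mulmx dotC. Qed.

(** The second hypothesis is the optimality condition of the prox at [W']. In terms of the
    differences a, e, b, c, all that is left is linear in the inner products. *)
Lemma primal_dual_step_ineq X X' x W W' w h h' :
  X' = X + K^T *m (y - K *m X) - A^T *m W' ->
  h' + dot (W + A *m (X + K^T *m (y - K *m X) - A^T *m W) - W') (w - W') <= h ->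
  2 * (lagrangian X' w h - lagrangian x W' h') <=
    metric (X - x) (W - w) - metric (X' - x) (W' - w)
    - dot (X' - X) (X' - X) + dot (K *m (X' - X)) (K *m (X' - X))
    - dot (K *m (x - X)) (K *m (x - X))
    - (dot (W' - W) (W' - W) - dot (A^T *m (W' - W)) (A^T *m (W' - W))).
Proof.
rewrite /lagrangian /metric.
have [a ->] : exists a, X = x + a by exists (X - x); rewrite addrC subrK.
have [e ->] : exists e, X' = x + a + e.
  by exists (X' - (x + a)); rewrite addrC subrK.
have [b ->] : exists b, W = w + b by exists (W - w); rewrite addrC subrK.
have [c ->] : exists c, W' = w + b + c.
  by exists (W' - (w + b)); rewrite addrC subrK.
set r := y - K *m (x + a); set s := K^T *m r => hx hp.
(* The primal update solved for the gradient term K^T r. *)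
have sE : s = e + A^T *m w + A^T *m b + A^T *m c.
  move: hx => /eqP; rewrite -[x + a + s - _]addrA (inj_eq (addrI _)) => /eqP ->.
  by rewrite -!addrA -!mulmxDr !addrA subrK.
have -> : K *m (x + a + e) - y = K *m e - r.
  by rewrite /r !mulmxDr; col_ring.
have -> : K *m x - y = - (K *m a) - r.
  by rewrite /r !mulmxDr; col_ring.
have -> : x + a - x = a by col_ring.
have -> : x + a + e - x = a + e by col_ring.
have -> : x + a + e - (x + a) = e by col_ring.
have -> : w + b - w = b by col_ring.
have -> : w + b + c - w = b + c by col_ring.
have -> : w + b + c - (w + b) = c by col_ring.
have -> : x - (x + a) = - a by col_ring.
have {}hp : h' + (dot c b + dot c c
    - dot (x + a + e + A^T *m c) (A^T *m b + A^T *m c)) <= h.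
  apply: le_trans hp; rewrite lerD2l.
  have -> : w - (w + b + c) = - (b + c) by col_ring.
  have -> : w + b + A *m (x + a + s - A^T *m (w + b)) - (w + b + c)
      = A *m (x + a + s - A^T *m (w + b)) - c.
    by col_ring.
  have -> : x + a + s - A^T *m (w + b) = x + a + e + A^T *m c.
    rewrite sE mulmxDr; col_ring.
  rewrite dotNr (dotDl (A *m _)) dotNl dot_mulmx mulmxDr (dotDr c); lra.
have se : dot s e = dot r (K *m e) by exact: dot_trmx_mulmx.
have sa : dot s a = dot r (K *m a) by exact: dot_trmx_mulmx.
move: hp se sa; rewrite sE !(dot_mulmx A) !mulmxDr !mulmxN.
clear hx sE; clearbody s; clearbody r; clear s.
move: (K *m e) (K *m a) (A^T *m w) (A^T *m b) (A^T *m c) => ke ka ow ob oc.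
rewrite !dotE.
rewrite (dotC ke r) (dotC ka r) (dotC e a) (dotC e ow) (dotC e ob) (dotC e oc).
rewrite (dotC a ow) (dotC a ob) (dotC a oc) (dotC oc ob) (dotC c b).
lra.
Qed.

(** The first equation of (V) cancels the terms linear in X - xs, and the subgradient inequality at
    [ws] absorbs the dual terms; the quadratic K-term is what remains. *)
Lemma lagrangian_gap_lower xs ws hs X W h :
  K^T *m (y - K *m xs) - A^T *m ws = 0 ->
  hs + dot (A *m xs) (W - ws) <= h ->
  dot (K *m (X - xs)) (K *m (X - xs)) <=
    2 * (lagrangian X ws hs - lagrangian xs W h).
Proof.
move=> /eqP; rewrite subr_eq0 => /eqP Kxs hW; rewrite /lagrangian.
have [e ->] : exists e, X = xs + e by exists (X - xs); rewrite addrC subrK.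
set r := y - K *m xs in Kxs *.
have -> : K *m (xs + e) - y = K *m e - r.
  by rewrite /r !mulmxDr; col_ring.
have -> : K *m xs - y = - r by rewrite /r opprB.
have -> : xs + e - xs = e by col_ring.
have : dot (A^T *m ws) e = dot r (K *m e) by rewrite -Kxs dot_trmx_mulmx.
clear Kxs; clearbody r; move: hW; rewrite mulmxDr !dotE !(dot_mulmx A) (dotC (K *m e) r).
rewrite (dotC e (A^T *m ws)).
lra.
Qed.

Hypothesis K_lt : opnorm K < Num.sqrt 2.
Hypothesis A_lt : opnorm A < 1.

Lemma sqr_opnormK_lt : opnorm K ^+ 2 < 2.
Proof.
rewrite -[ltRHS](@sqr_sqrtr _ 2)//.
by rewrite ltr_pXn2r// nnegrE ?opnorm_ge0 ?sqrtr_ge0.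
Qed.

Lemma sqr_opnormA_lt : opnorm A ^+ 2 < 1.
Proof. by rewrite expr_lt1 ?opnorm_ge0. Qed.

Lemma metric_ge0 x w : 0 <= metric x w.
Proof.
have := dot_trmx_mulmx_le A w; have := sqr_opnormA_lt.
have := dot_ge0 x; have := dot_ge0 w; rewrite /metric; nra.
Qed.

(** The first entry is what the K-term leaves of |dx|^2, the second what the metric leaves of
    |dw|^2. The minimum also serves as coercivity constant of [metric]. *)
Definition descent_rate : R := Num.min (1 - opnorm K ^+ 2 / 2) (1 - opnorm A ^+ 2).

Lemma descent_rate_gt0 : 0 < descent_rate.
Proof.
rewrite lt_min; have := sqr_opnormK_lt; have := sqr_opnormA_lt.
by move=> h1 h2; apply/andP; split; lra.
Qed.

Lemma metric_ge x w : descent_rate * (dot x x + dot w w) <= metric x w.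
Proof.
rewrite /metric; have := dot_trmx_mulmx_le A w.
have x0 := dot_ge0 x; have w0 := dot_ge0 w.
have c0 := descent_rate_gt0; have := sqr_ge0 (opnorm A).
have : descent_rate <= 1 - opnorm A ^+ 2 by rewrite ge_min lexx orbT.
nra.
Qed.

Lemma metric_le x w : metric x w <= dot x x + dot w w.
Proof. by rewrite /metric; have := dot_ge0 (A^T *m w); lra. Qed.

Lemma fejer_step xs ws hs X X' W W' h' :
  X' = X + K^T *m (y - K *m X) - A^T *m W' ->
  h' + dot (W + A *m (X + K^T *m (y - K *m X) - A^T *m W) - W') (ws - W') <= hs ->
  K^T *m (y - K *m xs) - A^T *m ws = 0 ->
  hs + dot (A *m xs) (W' - ws) <= h' ->
  metric (X' - xs) (W' - ws)
    + descent_rate * (dot (X' - X) (X' - X) + dot (W' - W) (W' - W))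
  <= metric (X - xs) (W - ws).
Proof.
move=> hx hp Kxs hW.
have h1 := primal_dual_step_ineq xs hx hp.
have h2 := lagrangian_gap_lower X' Kxs hW.
have h3 := dot_mulmx_le K (X' - X).
have h4 := dot_trmx_mulmx_le A (W' - W).
(* Passing through [xs] lets the two available K-terms absorb half of |K (X' - X)|^2. *)
have h5 : dot (K *m (X' - X)) (K *m (X' - X)) <=
    2 * (dot (K *m (X' - xs)) (K *m (X' - xs)) + dot (K *m (xs - X)) (K *m (xs - X))).
  apply: le_trans (dot_sum2 _ _); rewrite -mulmxDr.
  by rewrite addrA subrK.
have a0 := dot_ge0 (X' - X); have b0 := dot_ge0 (W' - W).
have h6 : descent_rate * dot (X' - X) (X' - X) <=
    (1 - opnorm K ^+ 2 / 2) * dot (X' - X) (X' - X).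
  by rewrite ler_wpM2r// ge_min lexx.
have h7 : descent_rate * dot (W' - W) (W' - W) <=
    (1 - opnorm A ^+ 2) * dot (W' - W) (W' - W).
  by rewrite ler_wpM2r// ge_min lexx orbT.
lra.
Qed.

End OneStep.

(** * Averages of iterates *)

Section Averages.
Variable R : realType.

Lemma averageE n (u : nat -> 'cV[R]_n) N :
  average u N = N%:R^-1 *: \sum_(0 <= i < N) u i.+1.
Proof. by rewrite /average big_add1. Qed.

Lemma scale_average n (u : nat -> 'cV[R]_n) N : (0 < N)%N ->
  N%:R *: average u N = \sum_(0 <= i < N) u i.+1.
Proof. by move=> N0; rewrite averageE scalerA mulfV ?scale1r// pnatr_eq0 -lt0n. Qed.

(** Jensen for the square: each |r_i|^2 is at least the tangent 2 <r_i, v> - |v|^2 at the residual v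
    of the average, and these tangents sum to N |v|^2. *)
Lemma sqr_residual_average p d (K : 'M[R]_(p, d)) y (u : nat -> 'cV[R]_d) N :
  (0 < N)%N ->
  N%:R * dot (K *m average u N - y) (K *m average u N - y) <=
    \sum_(0 <= i < N) dot (K *m u i.+1 - y) (K *m u i.+1 - y).
Proof.
move=> N0; set v := K *m average u N - y.
have vE : \sum_(0 <= i < N) (K *m u i.+1 - y) = N%:R *: v.
  rewrite sumrB -mulmx_sumr -scale_average// scalerBr -scalemxAr.
  by rewrite sumr_const_nat subn0 (scaler_nat N y).
have : \sum_(0 <= i < N) (2 * dot (K *m u i.+1 - y) v - dot v v) <=
    \sum_(0 <= i < N) dot (K *m u i.+1 - y) (K *m u i.+1 - y).
  apply: ler_sum => i _; have := dot_ge0 (K *m u i.+1 - y - v).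
  by rewrite dotDl !(dotDr _ _ (- v)) !dotNl !dotNr (dotC v (_ - _)); lra.
apply: le_trans.
rewrite sumrB -mulr_sumr -dot_suml vE dotZl sumr_const_nat subn0 -mulr_natl.
lra.
Qed.

Lemma dot_col_mx n1 n2 (a c : 'cV[R]_n1) (b e : 'cV[R]_n2) :
  dot (col_mx a b) (col_mx c e) = dot a c + dot b e.
Proof.
rewrite /dot big_split_ord/=; congr (_ + _); apply: eq_bigr => i _.
  by rewrite !col_mxEu.
by rewrite !col_mxEd.
Qed.

End Averages.

(** * Solutions of (V), saddle points and the primal objective *)

Section PrimalDual.
Variables (R : realType) (p d m : nat) (K : 'M[R]_(p, d)) (A : 'M[R]_(m, d)).
Variables (y : 'cV[R]_p) (H : 'cV[R]_m -> \bar R).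
Hypotheses (H_proper : eproper H) (H_lsc : dot_lsc H) (H_convex : fin_convex H).
Local Notation H' := (convex_conjugate H).

Lemma saddle_objE x w h : H' w = h%:E ->
  saddle_obj K A y H x w = (lagrangian K A y x w h)%:E.
Proof. by move=> Hw; rewrite /saddle_obj Hw -EFinB sqr_enorm. Qed.

Lemma saddle_obj_oo x w : H' w = +oo%E -> saddle_obj K A y H x w = -oo%E.
Proof. by move=> Hw; rewrite /saddle_obj Hw. Qed.

(** The prox equation means that A x is a subgradient of the conjugate at w, because (w + A x) - w =
    A x. *)
Lemma variational_solutionP x w : variational_solution K A y H x w <->
  K^T *m (y - K *m x) - A^T *m w = 0 /\
  exists h, H' w = h%:E /\
    forall v, ((h + dot (A *m x) (v - w))%:E <= H' v)%E.
Proof.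
have wx : w + A *m x - w = A *m x by rewrite addrAC subrr add0r.
split=> -[Kx]; last first.
  by move=> [h [Hw wv]]; split => //; rewrite (prox_unique Hw)// wx.
move=> wE; split => //.
have [h] := conjugate_prox H_proper H_lsc H_convex (w + A *m x).
by rewrite -wE wx; exists h.
Qed.

Lemma solution_saddle_point x w : variational_solution K A y H x w ->
  saddle_point (saddle_obj K A y H) x w.
Proof.
move=> /variational_solutionP[Kx [h [Hw wv]]] x' w'; rewrite !(saddle_objE _ Hw); split.
  case Hw' : (H' w') (conjugate_Noo H_proper w') => [h'||]// _; last first.
    by rewrite saddle_obj_oo ?leNye.
  rewrite (saddle_objE _ Hw') lee_fin /lagrangian.
  by have := wv w'; rewrite Hw' lee_fin dotDr dotNr; lra.
have := @lagrangian_gap_lower _ _ _ _ K A y x w h x' w h Kx.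
rewrite subrr (dotC _ 0) dot0l addr0 lexx => /(_ isT).
by have := dot_ge0 (K *m (x' - x)); rewrite lee_fin; lra.
Qed.

(** If the primal value exceeded c, Fenchel-Moreau at A x would give a w with F(x, w) > c. *)
Lemma primal_obj_leP x (c : R) :
  (forall w, (saddle_obj K A y H x w <= c%:E)%E) -> (primal_obj K A y H x <= c%:E)%E.
Proof.
move=> Fc; rewrite /primal_obj sqr_enorm leNgt; apply/negP => cF.
have [a ca aH] : exists2 a,
    c < 2^-1 * dot (K *m x - y) (K *m x - y) + a & (a%:E < H (A *m x)%R)%E.
  case: (H _) cF => [h||]//.
    rewrite -EFinD lte_fin => cF.
    exists ((h + c - 2^-1 * dot (K *m x - y) (K *m x - y)) / 2); rewrite ?lte_fin; lra.
  move=> _; exists (c + 1); rewrite ?ltry//.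
  by have := dot_ge0 (K *m x - y); lra.
have [w [h [Hw aw]]] := fenchel_moreau H_proper H_lsc H_convex aH.
have := Fc w; rewrite (saddle_objE _ Hw) lee_fin /lagrangian (dotC _ w); lra.
Qed.

Lemma saddle_le_primal_obj x w : (saddle_obj K A y H x w <= primal_obj K A y H x)%E.
Proof.
case Hw : (H' w) (conjugate_Noo H_proper w) => [h||]// _; last first.
  by rewrite saddle_obj_oo ?leNye.
rewrite (saddle_objE _ Hw) /primal_obj sqr_enorm.
have /(conjugate_leP H_proper)/(_ (A *m x)) : (H' w <= h%:E)%E by rewrite Hw.
rewrite dotC; move/(leeD2l (2^-1 * dot (K *m x - y) (K *m x - y))%:E); apply: le_trans.
by rewrite -EFinD lee_fin /lagrangian; lra.
Qed.

Lemma primal_obj_solution x w : variational_solution K A y H x w ->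
  primal_obj K A y H x = saddle_obj K A y H x w.
Proof.
move=> xw; apply/eqP; rewrite eq_le saddle_le_primal_obj andbT.
have sp := solution_saddle_point xw.
have [_ [h [Hw _]]] := (variational_solutionP x w).1 xw.
rewrite (saddle_objE _ Hw); apply: primal_obj_leP => w'.
by rewrite -(saddle_objE _ Hw); have [] := sp x w'.
Qed.

Lemma solution_minimizer x w : variational_solution K A y H x w ->
  minimizer (primal_obj K A y H) x.
Proof.
move=> xw x'; rewrite (primal_obj_solution xw).
apply: le_trans (saddle_le_primal_obj x' w).
by have [] := solution_saddle_point xw x' w.
Qed.

(** * Iterates and ergodic estimates *)

Variables (x0 : 'cV[R]_d) (w0 : 'cV[R]_m).
Let x n := (primal_dual_seq K A y H x0 w0 n).1.
Let w n := (primal_dual_seq K A y H x0 w0 n).2.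
Let q n := w n + A *m (x n + K^T *m (y - K *m x n) - A^T *m w n).
(** The index is shifted since the conjugate may be infinite at the arbitrary start [w0], while
    later dual iterates are prox values. *)
Let h n := fine (H' (w n.+1)).
Let dx n := x n.+1 - x n.
Let dw n := w n.+1 - w n.

Lemma primal_dual_seqS n : w n.+1 = prox H' (q n) /\
  x n.+1 = x n + K^T *m (y - K *m x n) - A^T *m w n.+1.
Proof. by rewrite /q /x /w /primal_dual_seq iterS; case: (iter _ _ _). Qed.

Lemma dual_iterate n : H' (w n.+1) = (h n)%:E /\
  forall v, ((h n + dot (q n - w n.+1) (v - w n.+1))%:E <= H' v)%E.
Proof.
rewrite /h; have [-> _] := primal_dual_seqS n.
by have [g []] := conjugate_prox H_proper H_lsc H_convex (q n); move=> ->.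
Qed.

Hypotheses (K_lt : opnorm K < Num.sqrt 2) (A_lt : opnorm A < 1).

Lemma ergodic_sum x' w' h' N : H' w' = h'%:E ->
  \sum_(0 <= i < N) 2 *
    (lagrangian K A y (x i.+1) w' h' - lagrangian K A y x' (w i.+1) (h i)) <=
  dot (x' - x0) (x' - x0) + dot (w' - w0) (w' - w0) +
  \sum_(0 <= i < N) (dot (K *m dx i) (K *m dx i) - dot (dx i) (dx i)).
Proof.
move=> Hw'.
(* Keeping the final metric term makes the induction telescope; it is nonnegative and is then
   dropped. *)
suff : \sum_(0 <= i < N) 2 *
    (lagrangian K A y (x i.+1) w' h' - lagrangian K A y x' (w i.+1) (h i))
  + metric A (x N - x') (w N - w') <=
  metric A (x 0%N - x') (w 0%N - w') +
  \sum_(0 <= i < N) (dot (K *m dx i) (K *m dx i) - dot (dx i) (dx i)).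
  have := metric_ge0 A_lt (x N - x') (w N - w').
  have := metric_le A (x 0%N - x') (w 0%N - w').
  rewrite -(opprB x' (x 0%N)) -(opprB w' (w 0%N)) !(dotNl, dotNr) !opprK.
  lra.
elim: N => [|N IH]; first by rewrite !big_geq// add0r addr0.
rewrite !big_nat_recr//=.
have [_ xS] := primal_dual_seqS N; have [_ wS] := dual_iterate N.
have := wS w'; rewrite Hw' lee_fin => wSh.
have := primal_dual_step_ineq x' xS wSh.
rewrite -/(dx N) -/(dw N).
have := dot_ge0 (K *m (x' - x N)).
have := metric_ge0 A_lt 0 (dw N).
rewrite {1}/metric dot0l add0r.
lra.
Qed.

(** Jensen handles the residual and the conjugate, while the bilinear terms average exactly. *)
Lemma ergodic_average N : (0 < N)%N -> exists ht : R, H' (average w N) = ht%:E /\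
  forall x' w' (h' : R), H' w' = h'%:E ->
  (2 * N%:R) * (lagrangian K A y (average x N) w' h' -
              lagrangian K A y x' (average w N) ht) <=
  dot (x' - x0) (x' - x0) + dot (w' - w0) (w' - w0) +
  \sum_(0 <= i < N) (dot (K *m dx i) (K *m dx i) - dot (dx i) (dx i)).
Proof.
move=> N0.
have Nr : 0 < N%:R :> R by rewrite ltr0n.
have := conjugate_average H_proper (u := fun i => w i.+1) N0 (fun i => (dual_iterate i).1).
rewrite -averageE.
case: (H' _) (conjugate_Noo H_proper (average w N)) => [ht||]// _.
rewrite lee_fin => hth; exists ht; split => // x' w' h' Hw'.
apply: le_trans (ergodic_sum x' N Hw').
have := sqr_residual_average K y x N0.
have constE (a : R) : \sum_(0 <= i < N) a = N%:R * a.
  by rewrite sumr_const_nat subn0 mulr_natl.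
rewrite -mulr_sumr.
have -> : \sum_(0 <= i < N) (lagrangian K A y (x i.+1) w' h' -
      lagrangian K A y x' (w i.+1) (h i)) =
    2^-1 * \sum_(0 <= i < N) dot (K *m x i.+1 - y) (K *m x i.+1 - y)
    + \sum_(0 <= i < N) dot (A *m x i.+1) w' - N%:R * h'
    - (N%:R * (2^-1 * dot (K *m x' - y) (K *m x' - y))
       + \sum_(0 <= i < N) dot (A *m x') (w i.+1) - \sum_(0 <= i < N) h i).
  rewrite sumrB; congr (_ - _); rewrite /lagrangian sumrB big_split/=.
    by rewrite mulr_sumr constE.
  by rewrite constE.
rewrite /lagrangian.
have -> : \sum_(0 <= i < N) dot (A *m x i.+1) w' = N%:R * dot (A *m average x N) w'.
  by rewrite -dot_suml -mulmx_sumr -scale_average// -scalemxAr dotZl.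
have -> : \sum_(0 <= i < N) dot (A *m x') (w i.+1) = N%:R * dot (A *m x') (average w N).
  under eq_bigr do rewrite dotC.
  by rewrite -dot_suml -scale_average// dotZl dotC.
have : N%:R * ht <= \sum_(0 <= i < N) h i by rewrite mulrC -ler_pdivlMr// mulrC.
lra.
Qed.

(** * Fejer monotonicity and convergence of the iterates *)

Section Solution.
Variables (xs : 'cV[R]_d) (ws : 'cV[R]_m).
Hypothesis sol : variational_solution K A y H xs ws.
Let c := descent_rate K A.
Let E n := metric A (x n - xs) (w n - ws).
Let D n := dot (dx n) (dx n) + dot (dw n) (dw n).

Lemma fejer n : E n.+1 + c * D n <= E n.
Proof.
have [_ xS] := primal_dual_seqS n; have [Hw wS] := dual_iterate n.
have [Kxs [hs [Hws hsP]]] := (variational_solutionP xs ws).1 sol.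
have := wS ws; rewrite Hws lee_fin => wSh.
have := hsP (w n.+1); rewrite Hw lee_fin => hsh.
exact: fejer_step xS wSh Kxs hsh.
Qed.

Let c0 : 0 < c := descent_rate_gt0 K_lt A_lt.

Let D0 n : 0 <= D n.
Proof. by rewrite addr_ge0 ?dot_ge0. Qed.

Lemma fejer_mono n k : (n <= k)%N -> E k <= E n.
Proof.
elim: k => [|k IH]; first by rewrite leqn0 => /eqP ->.
rewrite leq_eqVlt => /predU1P[->//|/IH].
by have := fejer k; have := mulr_ge0 (ltW c0) (D0 k); lra.
Qed.

Lemma sum_increments N : \sum_(0 <= i < N) D i <= E 0 / c.
Proof.
rewrite ler_pdivlMr// mulrC.
suff : E N + c * \sum_(0 <= i < N) D i <= E 0.
  by have := metric_ge0 A_lt (x N - xs) (w N - ws); rewrite -/(E N); lra.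
elim: N => [|N IH]; first by rewrite big_geq// mulr0 addr0.
by rewrite big_nat_recr//= mulrDr; have := fejer N; lra.
Qed.

Lemma increments_small e : 0 < e -> exists N, forall k, (N <= k)%N -> D k < e.
Proof.
move=> e0.
have /cvg_series_cvg_0 : cvgn (series D).
  apply: nondecreasing_is_cvgn.
    by apply: nondecreasing_series => i _ _; exact: D0.
  by exists (E 0 / c) => _ [N _ <-]; exact: sum_increments.
move/cvgrPdist_lt => /(_ _ e0)[N _ hN]; exists N => k Nk.
by have := hN k Nk; rewrite sub0r normrN ger0_norm.
Qed.

(** Since |K|^2 < 2, each term is at most |dx|^2. This supplies the constant C_1. *)
Lemma sum_defect N : \sum_(0 <= i < N)
    (dot (K *m dx i) (K *m dx i) - dot (dx i) (dx i)) <= E 0 / c.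
Proof.
apply: le_trans (sum_increments N); apply: ler_sum => i _.
have := dot_mulmx_le K (dx i); have := sqr_opnormK_lt K_lt.
have := dot_ge0 (dw i); have := dot_ge0 (dx i); rewrite /D; nra.
Qed.

Lemma cluster_point : exists xd wd, forall e N, 0 < e -> exists2 k, (N <= k)%N &
  dot (x k - xd) (x k - xd) + dot (w k - wd) (w k - wd) < e.
Proof.
(* Stacking both components yields a cluster point along common indices. *)
pose u k := col_mx (x k - xs) (w k - ws).
have uE k : dot (u k) (u k) <= E 0 / c.
  rewrite ler_pdivlMr// mulrC dot_col_mx (le_trans (metric_ge K_lt A_lt _ _))//.
  exact: fejer_mono.
have [l lP] := bounded_seq_cluster uE.
exists (xs + usubmx l), (ws + dsubmx l) => e N e0.
have [k Nk] := lP e N e0; exists k => //.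
rewrite !opprD !addrA -dot_col_mx.
by rewrite -add_col_mx -opp_col_mx vsubmxK.
Qed.

Lemma solution_limit : exists xd wd, variational_solution K A y H xd wd /\
  forall e N, 0 < e -> exists2 k, (N <= k)%N &
  dot (x k - xd) (x k - xd) + dot (w k - wd) (w k - wd) < e.
Proof.
have [xd [wd xwd]] := cluster_point; exists xd, wd; split; last exact: xwd.
(* Increments are small at all large indices and iterates are close at arbitrarily large ones, so
   one index serves both. *)
have near0 e : 0 < e -> exists k,
    dot (x k - xd) (x k - xd) + dot (w k - wd) (w k - wd) + D k < e.
  move=> e0; have e20 : 0 < e / 2 by rewrite divr_gt0.
  have [N DN] := increments_small e20; have [k Nk xwk] := xwd _ N e20.
  by exists k; have := DN k Nk; lra.
have Kle v : dot (K *m v) (K *m v) <= 2 * dot v v.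
  by have := dot_mulmx_le K v; have := sqr_opnormK_lt K_lt; have := dot_ge0 v; nra.
have KTle v : dot (K^T *m v) (K^T *m v) <= 2 * dot v v.
  by have := dot_trmx_mulmx_le K v; have := sqr_opnormK_lt K_lt; have := dot_ge0 v; nra.
have Ale v : dot (A *m v) (A *m v) <= dot v v.
  by have := dot_mulmx_le A v; have := sqr_opnormA_lt A_lt; have := dot_ge0 v; nra.
have ATle v : dot (A^T *m v) (A^T *m v) <= dot v v.
  by have := dot_trmx_mulmx_le A v; have := sqr_opnormA_lt A_lt; have := dot_ge0 v; nra.
split.
  apply: dot_eq0; apply/ler_addgt0Pl => e e0; rewrite addr0.
  (* 16 is the factor 4 of [dot_sum4] times the largest coefficient, 4, from |K^T K v|^2 <= 4
     |v|^2. *)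
  have [|k] := near0 (e / 16); first by rewrite divr_gt0.
  have [_ xS] := primal_dual_seqS k.
  have -> : K^T *m (y - K *m xd) - A^T *m wd =
      dx k + K^T *m (K *m (x k - xd)) + A^T *m (w k - wd) + A^T *m dw k.
    rewrite /dx xS /dw !mulmxBr; col_ring.
  rewrite /D => tk; apply: le_trans (dot_sum4 _ _ _ _) _.
  have := KTle (K *m (x k - xd)); have := Kle (x k - xd).
  have := ATle (w k - wd); have := ATle (dw k).
  have := dot_ge0 (x k - xd); have := dot_ge0 (w k - wd).
  have := dot_ge0 (dx k); have := dot_ge0 (dw k).
  lra.
apply/eqP; rewrite -subr_eq0; apply/eqP/dot_eq0.
apply/ler_addgt0Pl => e e0; rewrite addr0.
(* 12 = 2 (2 + 4): [dot_sum2] outside, then [dot_sum2] on the dual displacement and [dot_sum4] on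
   the prox arguments. *)
have [|k] := near0 (e / 12); first by rewrite divr_gt0.
have [wS xS] := primal_dual_seqS k.
have qE : q k - (wd + A *m xd) =
    (w k - wd) + A *m (x k - xd) + A *m dx k + A *m (A^T *m dw k).
  rewrite /q /dx xS /dw !mulmxBr !mulmxDr !mulmxN; col_ring.
have := prox_nonexpansive H_proper H_lsc H_convex (q k) (wd + A *m xd).
rewrite -wS qE => pk.
have wk := dot_sum2 (dw k) (w k - wd).
rewrite /D => tk.
move: pk; set pd := prox H' _ => pk.
have -> : wd - pd = - (dw k + (w k - wd)) + (w k.+1 - pd) by rewrite /dw; col_ring.
apply: le_trans (dot_sum2 _ _) _.
rewrite dotNl dotNr opprK.
have := le_trans pk (dot_sum4 _ _ _ _).
have := Ale (x k - xd); have := Ale (dx k); have := Ale (A^T *m dw k).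
have := ATle (dw k).
have := dot_ge0 (x k - xd); have := dot_ge0 (w k - wd).
have := dot_ge0 (dx k); have := dot_ge0 (dw k).
lra.
Qed.

End Solution.

(** Fejer monotonicity with respect to the cluster point itself: once the metric distance is below c
    e, it stays so, and coercivity bounds the squared distance by e. *)
Lemma iterates_cvg xd wd : variational_solution K A y H xd wd ->
  (forall e N, 0 < e -> exists2 k, (N <= k)%N &
    dot (x k - xd) (x k - xd) + dot (w k - wd) (w k - wd) < e) ->
  x @ \oo --> xd /\ w @ \oo --> wd.
Proof.
move=> sol xwd; have c0 := descent_rate_gt0 K_lt A_lt.
have small e : 0 < e -> exists N, forall k, (N <= k)%N ->
    dot (x k - xd) (x k - xd) + dot (w k - wd) (w k - wd) < e.
  move=> e0; have [N _ xwN] := xwd _ 0%N (mulr_gt0 c0 e0).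
  exists N => k Nk; rewrite -(ltr_pM2l c0).
  apply: le_lt_trans (metric_ge K_lt A_lt _ _) _.
  apply: le_lt_trans (fejer_mono sol Nk) _.
  exact: le_lt_trans (metric_le _ _ _) xwN.
split; apply: cvg_cV => e /small[N Nk]; exists N => k /Nk.
  by have := dot_ge0 (w k - wd); lra.
by have := dot_ge0 (x k - xd); lra.
Qed.

End PrimalDual.

(** * Convergence, ergodic gap bound and primal rate assembled *)

Theorem theorem1 (R : realType) (p d m : nat)
    (K : 'M[R]_(p, d)) (A : 'M[R]_(m, d)) (y : 'cV[R]_p)
    (H : 'cV[R]_m -> \bar R)
    (H_proper : eproper H) (H_lsc : lower_semicontinuous H) (H_convex : econvex H)
    (K_lt : opnorm K < Num.sqrt 2) (A_lt : opnorm A < 1)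
    (V_solvable : exists x w, variational_solution K A y H x w)
    (x0 : 'cV[R]_d) (w0 : 'cV[R]_m) :
  let x (n : nat) := (primal_dual_seq K A y H x0 w0 n).1 in
  let w (n : nat) := (primal_dual_seq K A y H x0 w0 n).2 in
  let xt := average x in
  let wt := average w in
  let calF := primal_obj K A y H in
  let F := saddle_obj K A y H in
  exists (xd : 'cV[R]_d) (wd : 'cV[R]_m),
    [/\ [/\ x @ \oo --> xd, w @ \oo --> wd,
            variational_solution K A y H xd wd,
            minimizer calF xd & saddle_point F xd wd],
        [/\ xt @ \oo --> xd, wt @ \oo --> wd &
          exists C1 : R,
            [/\ 0 <= C1,
                (opnorm K <= 1 -> C1 = 0),
                (forall (N : nat) (x' : 'cV[R]_d) (w' : 'cV[R]_m), (1 <= N)%N ->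
                  (F (xt N) w' - F x' (wt N) <=
                   ((enorm (x' - x0) ^+ 2 + enorm (w' - w0) ^+ 2 + C1)
                      / (2 * N%:R))%:E)%E) &
                (forall N : nat, (1 <= N)%N ->
                  (0 <= gap F xd wd (xt N) (wt N))%E /\
                  (gap F xd wd (xt N) (wt N) <=
                   ((enorm (xd - x0) ^+ 2 + enorm (wd - w0) ^+ 2 + C1)
                      / (2 * N%:R))%:E)%E)]] &
        (exists2 r : R, 0 < r &
           forall w' : 'cV[R]_m, r < enorm w' -> convex_conjugate H w' = +oo%E) ->
        exists C2 : R, forall N : nat, (1 <= N)%N ->
          (0 <= calF (xt N) - calF xd)%E /\
          (calF (xt N) - calF xd <= (C2 / N%:R)%:E)%E].
Proof.
move=> x w xt wt calF F.
have Hlsc := lower_semicontinuous_dot H_lsc.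
have Hcvx := econvex_fin H_convex.
have [xs [ws sol0]] := V_solvable.
have [xd [wd [sol xwd]]] :=
  solution_limit H_proper Hlsc Hcvx x0 w0 K_lt A_lt sol0.
have [xcvg wcvg] := iterates_cvg H_proper Hlsc Hcvx K_lt A_lt sol xwd.
have sp := solution_saddle_point H_proper Hlsc Hcvx sol.
have xmin := solution_minimizer H_proper Hlsc Hcvx sol.
have [Kxd [hd [Hwd hdP]]] := (variational_solutionP K A y H_proper Hlsc Hcvx xd wd).1 sol.
pose B := metric A (x0 - xd) (w0 - wd) / descent_rate K A.
have B0 : 0 <= B.
  by rewrite divr_ge0 ?metric_ge0// ltW// descent_rate_gt0.
(* If |K| <= 1 the defect terms |K dx|^2 - |dx|^2 are nonpositive; otherwise [B] bounds their
   sum. *)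
pose C1 := if opnorm K <= 1 then 0 else B.
have C10 : 0 <= C1 by rewrite /C1; case: ifP.
have ergodic N : (0 < N)%N -> exists ht : R,
    convex_conjugate H (wt N) = ht%:E /\
    forall x' w' (h' : R), convex_conjugate H w' = h'%:E ->
    lagrangian K A y (xt N) w' h' - lagrangian K A y x' (wt N) ht <=
    (enorm (x' - x0) ^+ 2 + enorm (w' - w0) ^+ 2 + C1) / (2 * N%:R).
  move=> N0; have Nr : 0 < 2 * N%:R :> R by rewrite mulr_gt0 ?ltr0n.
  have [ht [Hwt htP]] := ergodic_average K y H_proper Hlsc Hcvx x0 w0 A_lt N0.
  exists ht; split => // x' w' h' Hw'.
  rewrite ler_pdivlMr// mulrC (le_trans (htP x' w' h' Hw'))// !sqr_enorm lerD2l.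
  rewrite /C1; case: ifPn => [K1|_]; last exact: sum_defect.
  apply: sumr_le0 => i _; rewrite subr_le0 (le_trans (dot_mulmx_le _ _))//.
  by rewrite ler_piMl ?dot_ge0// expr_le1// opnorm_ge0.
exists xd, wd; split.
- by split.
- split; [exact: cvg_average|exact: cvg_average|exists C1; split => //].
  + by rewrite /C1 => ->.
  + move=> N x' w' N0; have [ht [Hwt htP]] := ergodic N N0.
    rewrite /F (saddle_objE _ _ _ _ Hwt).
    (* If the conjugate is infinite at [w'], the left side is -oo minus a real number. *)
    case Hw' : (convex_conjugate H w') (conjugate_Noo H_proper w') => [h'||]// _.
      by rewrite (saddle_objE _ _ _ _ Hw') -EFinB lee_fin htP.
    by rewrite saddle_obj_oo// leNye.
  + move=> N N0; have [ht [Hwt htP]] := ergodic N N0.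
    rewrite /gap /F (saddle_objE _ _ _ _ Hwt) (saddle_objE _ _ _ _ Hwd) -EFinB !lee_fin htP//.
    split => //.
    have := hdP (wt N); rewrite Hwt lee_fin => hdt.
    have := lagrangian_gap_lower (xt N) Kxd hdt.
    by have := dot_ge0 (K *m (xt N - xd)); lra.
- move=> [r r0 Hr].
  (* Only |w'| <= r matters, where |w' - w0| <= r + |w0|; the 2 comes from 2 N. *)
  exists ((enorm (xd - x0) ^+ 2 + (r + enorm w0) ^+ 2 + C1) / 2) => N N0.
  set C2 := (_ / 2).
  have Fd : calF xd = (lagrangian K A y xd wd hd)%:E.
    by rewrite /calF (primal_obj_solution H_proper Hlsc Hcvx sol) (saddle_objE _ _ _ _ Hwd).
  rewrite sube_ge0 ?Fd// -Fd; split; first exact: xmin.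
  rewrite Fd leeBlDr// -EFinD; apply: primal_obj_leP => // w'.
  case Hw' : (convex_conjugate H w') (conjugate_Noo H_proper w') => [h'||]// _; last first.
    by rewrite saddle_obj_oo// leNye.
  have w'r : enorm w' <= r.
    by rewrite leNgt; apply/negP => /Hr; rewrite Hw'.
  have [ht [Hwt htP]] := ergodic N N0.
  rewrite (saddle_objE _ _ _ _ Hw') lee_fin.
  have := htP xd w' h' Hw'.
  (* The saddle property replaces F(xd, wt N) by F(xd, wd), which is the minimal primal value. *)
  have [+ _] := sp xd (wt N).
  rewrite (saddle_objE _ _ _ _ Hwt) (saddle_objE _ _ _ _ Hwd) lee_fin.
  have : (enorm (xd - x0) ^+ 2 + enorm (w' - w0) ^+ 2 + C1) / (2 * N%:R) <= C2 / N%:R.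
    rewrite /C2 -[leRHS]mulrA -invfM ler_wpM2r ?invr_ge0 ?mulr_ge0// lerD2r lerD2l.
    rewrite lerXn2r ?nnegrE ?enorm_ge0 ?addr_ge0 ?enorm_ge0 ?(ltW r0)//.
    by rewrite (le_trans (enormD _ _))// enormN lerD2r.
  lra.
Qed.
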